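(* Assume that there exists a unique invariant probability measure $\mu^\star\in\mathcal{M}_+(\mathbf{X})$, and let $\mathbf{S}\subseteq\mathbf{X}$ be its support. Suppose that $\mathbf{S}$ has nonempty interior and that there exist sequences $(\delta_r)_{r\in\mathbb{N}}$, $(\alpha_r)_{r\in\mathbb{N}}$, $(d_r)_{r\in\mathbb{N}}$ such that: (1) $(\delta_r)_{r\in\mathbb{N}}$ is a decreasing sequence of positive numbers converging to $0$; (2) for every $r\in\mathbb{N}$, $d_r$ is the smallest positive integer such that $$2^{\,3-\frac{\delta_r d_r}{\delta_r+\operatorname{diam}\mathbf{S}}}\; d_r^{\,n}\Big(\frac{e}{n}\Big)^n\exp\Big(\frac{n^2}{d_r}\Big)\le\alpha_r;$$ (3) for every $r\in\mathbb{N}$, $$\alpha_r:=\frac{\delta_r^n\,\omega_n}{\operatorname{vol}\mathbf{S}}\cdot\frac{(d_r+1)(d_r+2)(d_r+3)}{(d_r+n+1)(d_r+n+2)(2d_r+n+6)} .$$ For every $r\in\mathbb{N}$, let $$\mathbf{S}^r:=\Big\{\mathbf{x}\in\mathbf{X}:\ p_{\mu^\star,d_r}(\mathbf{x})\le\frac{\binom{d_r+n}{n}}{\alpha_r}\Big\}.$$ Then $$\lim_{r\to\infty}\ \sup_{\mathbf{x}\in\mathbf{S}^r}\operatorname{dist}(\mathbf{x},\mathbf{S})=0 .$$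
   Context: Setting. $f=(f_1,\dots,f_n):\mathbb{R}^n\to\mathbb{R}^n$ is a polynomial map and $\mathbf{X}=\{\mathbf{x}\in\mathbb{R}^n: g_1(\mathbf{x})\ge0,\dots,g_m(\mathbf{x})\ge 0\}$ is a compact set, with $g_1,\dots,g_m\in\mathbb{R}[\mathbf{x}]$. Standing assumptions: for some integer $N$, one of the $g_j$ equals $N-\|\mathbf{x}\|_2^2$; and the moments of the Lebesgue measure on $\mathbf{X}$ are available analytically (i.e. are regarded as known). $\mathcal{M}_+(\mathbf{X})$ is the set of finite nonnegative Borel measures supported on $\mathbf{X}$. Invariance. Two cases are treated in parallel, and the result holds in each. Discrete time ($\mathbf{x}_{t+1}=f(\mathbf{x}_t)$): $\mu$ is invariant if $f_\#\mu=\mu$, where $f_\#\mu(\mathbf{A})=\mu(\{\mathbf{x}\in\mathbf{X}: f(\mathbf{x})\in\mathbf{A}\})$ for Borel $\mathbf{A}\subseteq\mathbf{X}$. Continuous time ($\dot{\mathbf{x}}=f(\mathbf{x})$): $\mu$ is invariant if $\mathrm{div}(f\mu)=0$ in the sense of distributions acting on $\mathcal{C}^1(\mathbf{X})$, i.e. $\int_{\mathbf{X}} \mathrm{grad}\,v\cdot f\,d\mu=0$ for all $v\in\mathcal{C}^1(\mathbf{X})$. Notation. $\operatorname{diam}\mathbf{S}$ is the diameter of $\mathbf{S}$, $\operatorname{vol}\mathbf{S}$ its Lebesgue volume, $\operatorname{dist}(\mathbf{x},\mathbf{S})$ the Euclidean distance from $\mathbf{x}$ to $\mathbf{S}$, and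 $\omega_n:=\frac{2\pi^{(n+1)/2}}{\Gamma((n+1)/2)}$ the surface of the $n$-dimensional unit sphere in $\mathbb{R}^{n+1}$. Christoffel polynomial. Let $\mu\in\mathcal{M}_+(\mathbf{X})$ have finite moments $u_\beta=\int\mathbf{x}^\beta d\mu$ and be such that for all $d\in\mathbb{N}$ the moment matrix $\mathbf{M}_d(\mathbf{u})=(u_{\beta+\gamma})_{|\beta|,|\gamma|\le d}$ is positive definite. With $\mathbf{v}_d(\mathbf{x})$ the vector of monomials of degree at most $d$ sorted by graded lexicographic order, the Christoffel polynomial is $p_{\mu,d}:\mathbf{X}\to\mathbb{R}$, $p_{\mu,d}(\mathbf{x}):=\mathbf{v}_d(\mathbf{x})^T\mathbf{M}_d(\mathbf{u})^{-1}\mathbf{v}_d(\mathbf{x})$. *)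

(* Defs.v *)
From HB Require Import structures.
From mathcomp Require Import all_boot all_order all_algebra.
From mathcomp Require Import all_classical all_reals all_analysis.
From mathcomp Require Import -(notations) mpoly.

Set Implicit Arguments.
Unset Strict Implicit.
Unset Printing Implicit Defensive.

Import Order.TTheory GRing.Theory Num.Theory.
Import numFieldNormedType.Exports.

Local Open Scope classical_set_scope.
Local Open Scope ring_scope.

Notation borel R n := (g_sigma_algebraType (@open 'rV[R]_n)).

(* The library norm on 'rV[R]_n is the sup norm; it induces the same topology,
   but distances in the statement are Euclidean. *)
Definition eucl_norm (R : realType) (n : nat) (x : 'rV[R]_n) : R :=
  Num.sqrt (\sum_(i < n) x ord0 i ^+ 2).

Definition eucl_dist (R : realType) (n : nat) (x y : 'rV[R]_n) : R :=
  eucl_norm (x - y).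

Definition eucl_dist_to (R : realType) (n : nat) (x : 'rV[R]_n)
    (S : set 'rV[R]_n) : R :=
  inf [set eucl_dist x y | y in S].

Definition eucl_diam (R : realType) (n : nat) (S : set 'rV[R]_n) : R :=
  sup [set eucl_dist x y | x in S & y in S].

Definition box (R : realType) (n : nat) (a b : 'rV[R]_n) : set 'rV[R]_n :=
  [set x | forall i, a ord0 i <= x ord0 i <= b ord0 i].

(* n-dimensional Lebesgue (outer) measure: infimum of the total volume of
   countable covers by boxes. *)
Definition vol (R : realType) (n : nat) (A : set 'rV[R]_n) : \bar R :=
  ereal_inf
    [set (\sum_(0 <= k <oo)
            (\prod_(i < n) ((ab k).2 ord0 i - (ab k).1 ord0 i))%:E)%E
    | ab in [set ab : nat -> 'rV[R]_n * 'rV[R]_n |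
        (forall k i, (ab k).1 ord0 i <= (ab k).2 ord0 i)
        /\ A `<=` \bigcup_k box (ab k).1 (ab k).2]].

Definition Gamma_fun (R : realType) (s : R) : R :=
  \int[lebesgue_measure]_(t in `]0, +oo[) (t `^ (s - 1) * expR (- t)).

(* Surface of the n-dimensional unit sphere of R^(n+1). *)
Definition sphere_surface (R : realType) (n : nat) : R :=
  2 * pi `^ (n.+1%:R / 2) / Gamma_fun (n.+1%:R / 2).

Definition evalp (R : realType) (n : nat) (p : mpoly n R)
    (x : 'rV[R]_n) : R :=
  meval (fun i => x ord0 i) p.

Definition polymap (R : realType) (n : nat) (f : 'I_n -> mpoly n R)
    (x : 'rV[R]_n) : 'rV[R]_n :=
  \row_i evalp (f i) x.

Definition semialg (R : realType) (n m : nat) (g : 'I_m -> mpoly n R) :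
    set 'rV[R]_n :=
  [set x | forall j, 0 <= evalp (g j) x].

(* N - ||x||^2 *)
Definition ball_constraint (R : realType) (n : nat) (N : int) :
    mpoly n R :=
  mpolyC n N%:~R
    - \sum_(i < n) mpolyX R (mnm1 i) ^+ 2.

(* X is closed in every use below, so this amounts to the (topological)
   support being included in X. *)
Definition supported_on (R : realType) (n : nat)
    (mu : {measure set (borel R n) -> \bar R}) (X : set 'rV[R]_n) : Prop :=
  mu (~` X) = 0%E.

Definition measure_support (R : realType) (n : nat)
    (mu : {measure set (borel R n) -> \bar R}) : set 'rV[R]_n :=
  [set x | forall U : set 'rV[R]_n, open U -> U x -> (0 < mu U)%E].

Inductive time_kind := discrete_time | continuous_time.

Definition partial_derivative (R : realType) (n : nat) (v : 'rV[R]_n -> R)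
    (i : 'I_n) (x : 'rV[R]_n) : R :=
  'D_(delta_mx ord0 i) v x.

Definition C1 (R : realType) (n : nat) (v : 'rV[R]_n -> R) : Prop :=
  (forall x, differentiable v x) /\
  (forall i, continuous (partial_derivative v i)).

(* C^1(X) is the space of (restrictions to X of) C^1 functions on R^n. *)
Definition invariant_measure (R : realType) (n : nat) (t : time_kind)
    (f : 'rV[R]_n -> 'rV[R]_n) (X : set 'rV[R]_n)
    (mu : {measure set (borel R n) -> \bar R}) : Prop :=
  match t with
  | discrete_time =>
      forall A : set (borel R n), measurable A -> A `<=` X ->
        mu (X `&` f @^-1` A) = mu A
  | continuous_time =>
      forall v : 'rV[R]_n -> R, C1 v ->
        (\int[mu]_(x in X)
          (\sum_(i < n) partial_derivative v i x * f x ord0 i)%:E = 0)%E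
  end.

Definition monom (R : realType) (n : nat) (b : multinom n)
    (x : 'rV[R]_n) : R :=
  \prod_(i < n) x ord0 i ^+ b i.

(* mnmc_le compares total degrees first, then exponents
   lexicographically. *)
Definition monoms (n d : nat) : seq (multinom n) :=
  sort (@mnmc_le n)
    [seq bmnm b | b <- enum {: bmultinom n d.+1}].

Definition monom_vec (R : realType) (n d : nat) (x : 'rV[R]_n) :
    'cV[R]_(size (monoms n d)) :=
  \col_k monom (tnth (in_tuple (monoms n d)) k) x.

Definition measure_moment (R : realType) (n : nat)
    (mu : {measure set (borel R n) -> \bar R}) (b : multinom n) : R :=
  \int[mu]_x monom b x.

Definition moment_matrix (R : realType) (n d : nat)
    (mu : {measure set (borel R n) -> \bar R}) : 'M[R]_(size (monoms n d)) :=
  let s := in_tuple (monoms n d) in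
  \matrix_(k, l) measure_moment mu (mnm_add (tnth s k) (tnth s l)).

(* The moment matrix is invertible for the measures considered (those whose
   moment matrices are positive definite), so invmx is a genuine inverse. *)
Definition christoffel (R : realType) (n d : nat)
    (mu : {measure set (borel R n) -> \bar R}) (x : 'rV[R]_n) : R :=
  ((monom_vec d x)^T *m invmx (moment_matrix d mu) *m monom_vec d x) ord0 ord0.

(* alpha_r depends on d_r itself, so it is a function of the candidate degree:
   d_r is the least d > 0 with degree_lhs S delta_r d <= alpha_of S delta_r d. *)
Definition alpha_of (R : realType) (n : nat) (S : set 'rV[R]_n) (delta : R)
    (d : nat) : R :=
  delta ^+ n * sphere_surface R n / fine (vol S)
  * ((d + 1) * (d + 2) * (d + 3))%:R
  / ((d + n + 1) * (d + n + 2) * (2 * d + n + 6))%:R.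

Definition degree_lhs (R : realType) (n : nat) (S : set 'rV[R]_n) (delta : R)
    (d : nat) : R :=
  2 `^ (3 - delta * d%:R / (delta + eucl_diam S)) * d%:R ^+ n
  * (expR 1 / n%:R) ^+ n * expR (n%:R ^+ 2 / d%:R).

Definition is_least (P : nat -> Prop) (d : nat) : Prop :=
  P d /\ forall k, P k -> (d <= k)%N.

(* Main.v *)
(* The Christoffel polynomial is extremal: [q(x)^2 <= p_{mu,d}(x) int q^2 dmu]
   for every [q] of degree at most [d], by Cauchy-Schwarz for the moment form,
   which is definite because a polynomial vanishing on a ball is zero.  If
   [dist(x, S) > eps], apply this to the needle [q(y) = (1 - |y - x|^2 / M)^k]
   with [M] above the squared diameter of [X] and [k = d / 2] rounded down: it
   equals 1 at [x] and is at most [(1 - eps^2 / M)^k] mu-almost everywhere, so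
   [p_{mu,d}(x)] grows exponentially in [d] at a rate depending on [eps] only.
   The threshold [C(d_r + n, n) / alpha_r] is bounded, through condition (2), by
   a constant times [2 ^ (delta_r d_r / (delta_r + diam S))], whose rate tends
   to 0; as [alpha_r -> 0], such an [x] is outside [S^r] for large [r].
   The limit also requires [S^r] to be nonempty (the supremum of the empty set
   is [-oo]): the mean of [p_{mu,d}] is [C(d + n, n)], and [alpha_r < 1]
   eventually. *)
Require Import Defs.
From mathcomp Require Import all_boot all_order all_algebra.
From mathcomp Require Import all_classical all_reals all_analysis.
From mathcomp Require Import -(notations) mpoly.
From mathcomp Require Import measurable_realfun zify ring lra.

Import Order.TTheory GRing.Theory Num.Theory.
Import numFieldNormedType.Exports.

Local Open Scope classical_set_scope.
Local Open Scope ring_scope.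

(** * Polynomials vanishing on an open set *)

(** Uniqueness of base-[K] expansions: the lowest digit is the remainder modulo [K], and the
    quotient has one digit fewer. *)
Lemma digits_inj {n} (K : nat) (f g : 'I_n -> nat) :
  (forall i, (f i < K)%N) -> (forall i, (g i < K)%N) ->
  (\sum_(i < n) f i * K ^ i = \sum_(i < n) g i * K ^ i)%N -> f =1 g.
Proof.
elim: n f g => [|n IHn] f g fK gK; first by move=> _ [].
have shift (h : 'I_n.+1 -> nat) : (\sum_(i < n.+1) h i * K ^ i =
    (\sum_(i < n) h (lift ord0 i) * K ^ i) * K + h ord0)%N.
  rewrite big_ord_recl expn0 muln1 addnC big_distrl /=; congr addn.
  by apply: eq_bigr => i _; rewrite -mulnA -expnSr.
rewrite !shift => fg.
have K0 : (0 < K)%N by exact: leq_ltn_trans (fK ord0).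
have /= fg0 : f ord0 = g ord0.
  by move: (congr1 (modn^~ K) fg); rewrite !modnMDl !modn_small.
move: fg; rewrite fg0 => /addIn /eqP; rewrite eqn_pmul2r // => /eqP fg i.
have [j ->|->//] := unliftP ord0 i.
by apply: (IHn (f \o lift ord0) (g \o lift ord0)) => //= k.
Qed.

(** The points [e / (k + 2)] for [k < size p] are distinct roots inside the open interval, more than
    the degree allows. *)
Lemma poly_eq0_near0 {R : realType} (p : {poly R}) (e : R) : 0 < e ->
  (forall t, 0 < t < e -> p.[t] = 0) -> p = 0.
Proof.
move=> e0 pe; pose rs := [seq e / k.+2%:R | k <- iota 0 (size p)].
apply: (@roots_geq_poly_eq0 _ p rs); last by rewrite size_map size_iota.
  apply/allP => _ /mapP[k _ ->]; apply/rootP/pe.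
  by rewrite divr_gt0 //= ltr_pdivrMr // ltr_pMr // ltr1n.
rewrite map_inj_in_uniq ?iota_uniq // => i j _ _ /(mulfI (lt0r_neq0 e0)).
by move/invr_inj/eqP; rewrite eqr_nat => /eqP[].
Qed.

(* Kronecker substitution [x_i = t^(K^i)] with [K] above all exponents sends
   distinct monomials of [p] to distinct powers of [t]. *)
Lemma meval_eq0 {R : realType} {n} (p : mpoly n R) :
  (forall v, meval v p = 0) -> p = 0.
Proof.
move=> p0; pose K := msize p.
pose w (b : multinom n) := (\sum_(i < n) b i * K ^ i)%N.
pose q : {poly R} := \sum_(b <- msupp p) mcoeff b p *: 'X^(w b).
have q0 : q = 0.
  apply: (poly_eq0_near0 _ 1) => // t _.
  rewrite -(p0 (fun i => t ^+ (K ^ i))) mevalE /q horner_sum.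
  apply: eq_bigr => b _; rewrite !hornerE; congr (_ * _).
  by rewrite -prodrXr; apply: eq_bigr => i _; rewrite mulnC exprM.
have bK (b : multinom n) i : b \in msupp p -> (b i < K)%N.
  move=> /msize_mdeg_lt; apply: leq_ltn_trans.
  by rewrite mdegE (bigD1 i) //= leq_addr.
apply/mpolyP => b; rewrite mcoeff0.
have [bp|] := boolP (b \in msupp p); last exact: memN_msupp_eq0.
have : q`_(w b) = 0 by rewrite q0 coef0.
rewrite coef_sum (bigD1_seq b) ?msupp_uniq //= coefZ coefXn eqxx mulr1.
rewrite big_seq_cond big1 ?addr0 // => c /andP[cp cb].
rewrite coefZ coefXn; case: eqP => [/digits_inj E|]; last by rewrite mulr0.
by case/eqP: cb; apply/mnmP => i; rewrite E // => j; exact: bK.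
Qed.

(** On the line from a point of [U] to an arbitrary [v], [p] is a univariate polynomial [q] in [t]
    that vanishes for small [t > 0], hence also at [t = 1], which is [v]. *)
Lemma evalp_open_eq0 {R : realType} {n} (p : mpoly n R) (U : set 'rV[R]_n) :
  U !=set0 -> open U -> (forall y, U y -> evalp p y = 0) -> p = 0.
Proof.
move=> [x Ux] oU pU; apply: meval_eq0 => v.
pose z : 'rV[R]_n := \row_i v i - x.
pose q : {poly R} := \sum_(b <- msupp p)
  mcoeff b p *: \prod_(i < n) ((x ord0 i)%:P + z ord0 i *: 'X) ^+ b i.
have qE t : q.[t] = evalp p (x + t *: z).
  rewrite /evalp mevalE /q horner_sum; apply: eq_bigr => b _.
  rewrite hornerZ horner_prod; congr (_ * _); apply: eq_bigr => i _.
  by rewrite !hornerE !mxE mulrC.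
have q0 : q = 0.
  have : (x + t *: z) @[t --> 0] --> (x : 'rV[R]_n).
    rewrite -[X in _ --> X]addr0 -(scale0r z).
    by apply: cvgD; [exact: cvg_cst|apply: cvgZr_tmp; exact: cvg_id].
  move/(_ _ (open_nbhs_nbhs (conj oU Ux))) => /nbhs_ballP[e /= e0 eU].
  apply: (poly_eq0_near0 _ e) => // t /andP[t0 te].
  rewrite qE; apply: pU; apply: eU => /=.
  by rewrite -ball_normE /= sub0r normrN gtr0_norm.
have -> : meval v p = evalp p (x + 1 *: z).
  by apply: meval_eq => i; rewrite !mxE mul1r addrC subrK.
by rewrite -qE q0 horner0.
Qed.

Lemma evalp_sum {R : realType} {n} (I : Type) (r : seq I) (P : pred I)
    (F : I -> mpoly n R) x :
  evalp (\sum_(i <- r | P i) F i) x = \sum_(i <- r | P i) evalp (F i) x.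
Proof. exact: raddf_sum. Qed.

Lemma evalp_continuous {R : realType} {n} (p : mpoly n R) :
  continuous (evalp p).
Proof.
move=> x; rewrite /evalp; under eq_fun do rewrite mevalE.
apply: (@continuous_big R _ +%R 0 xpredT _ 'rV[R]_n) => [|b _ {}x].
  exact: add_continuous.
apply: (@continuousM _ _ (cst (mcoeff b p)) _ x); first exact: cst_continuous.
apply: (@continuous_big R _ *%R 1 xpredT _ 'rV[R]_n) => [|i _ {}x].
  exact: mul_continuous.
have := @exprn_continuous R (b i) (x ord0 i).
apply: (@cvg_comp _ _ _ (fun x : 'rV[R]_n => x ord0 i) _ (nbhs x)).
exact: coord_continuous.
Qed.

(** * Integration as a linear form on polynomials *)

Definition pint {R : realType} {n} (mu : {measure set (borel R n) -> \bar R})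
  (p : mpoly n R) : R := \int[mu]_x evalp p x.

(** The form in which finiteness of the moments is used: it makes [pint] linear. *)
Definition poly_integrable {R : realType} {n}
    (mu : {measure set (borel R n) -> \bar R}) :=
  forall p : mpoly n R, mu.-integrable setT (EFin \o evalp p).

Section pint.
Context {R : realType} {n : nat} {mu : {measure set (borel R n) -> \bar R}}.
Hypothesis mu_int : poly_integrable mu.

Lemma pintD p q : pint mu (p + q) = pint mu p + pint mu q.
Proof.
rewrite /pint -RintegralD //.
by apply: eq_Rintegral => x _; exact: mevalD.
Qed.

Lemma pintZ c p : pint mu (c *: p) = c * pint mu p.
Proof.
rewrite /pint -RintegralZl //.
by apply: eq_Rintegral => x _; exact: mevalZ.
Qed.

Lemma pint0 : pint mu 0 = 0.
Proof. by rewrite -(scale0r 0) pintZ mul0r. Qed.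

Lemma pint_sum (I : Type) (r : seq I) (P : pred I) (F : I -> mpoly n R) :
  pint mu (\sum_(i <- r | P i) F i) = \sum_(i <- r | P i) pint mu (F i).
Proof. exact: (big_morph _ pintD pint0). Qed.

Lemma pint_sqr_ge0 p : 0 <= pint mu (p * p).
Proof.
by apply: Rintegral_ge0 => x _; rewrite /evalp mevalM -expr2 sqr_ge0.
Qed.

Lemma pintX b : pint mu (mpolyX R b) = measure_moment mu b.
Proof. by apply: eq_Rintegral => x _; exact: mevalX. Qed.

(** The form [int (s p + t q)^2] is nonnegative; at [(s, t) = (c, -b)] it equals [c (a c - b^2)]. *)
Lemma pint_cauchy_schwarz p q :
  pint mu (p * q) ^+ 2 <= pint mu (p * p) * pint mu (q * q).
Proof.
set a := pint mu (p * p); set b := pint mu (p * q); set c := pint mu (q * q).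
have quad s t : 0 <= s ^+ 2 * a + 2 * s * t * b + t ^+ 2 * c.
  have := pint_sqr_ge0 (s *: p + t *: q).
  rewrite (_ : _ * _ = s ^+ 2 *: (p * p) + (2 * s * t) *: (p * q)
    + t ^+ 2 *: (q * q)); first by rewrite !pintD !pintZ.
  rewrite -!mul_mpolyC !rmorphM rmorph_nat /=.
  by ring.
have a0 : 0 <= a by exact: pint_sqr_ge0.
have c0 : 0 <= c by exact: pint_sqr_ge0.
have [c00|cn0] := eqVneq c 0.
  (* When [c = 0] the form at this point is [- b^2 (a + 2)], which forces [b = 0]. *)
  by have := quad b (- (a + 1)); rewrite c00; nra.
have {}c0 : 0 < c by rewrite lt_def cn0.
rewrite -subr_ge0 -(pmulr_rge0 _ c0).
rewrite (_ : c * _ = c ^+ 2 * a + 2 * c * (- b) * b + (- b) ^+ 2 * c) ?quad //.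
by ring.
Qed.

End pint.

(** * The Christoffel polynomial: extremality and mean *)

Section christoffel.
Context {R : realType} {n d : nat} {mu : {measure set (borel R n) -> \bar R}}.
Let sz := size (monoms n d).
Let M := moment_matrix d mu.

(** Coordinates in the monomial basis, through which statements on matrices become statements on
    polynomials. *)
Definition vpoly (c : 'rV[R]_sz) : mpoly n R :=
  \sum_k c ord0 k *: mpolyX R (tnth (in_tuple (monoms n d)) k).

Lemma mem_monoms b : (b \in monoms n d) = (mdeg b < d.+1)%N.
Proof.
rewrite mem_sort; apply/mapP/idP => [[c _ ->]|bd]; first exact: bmdeg.
by exists (BMultinom bd) => //; rewrite mem_enum.
Qed.

Lemma monoms_uniq : uniq (monoms n d).
Proof. by rewrite sort_uniq map_inj_uniq ?enum_uniq //; exact: val_inj. Qed.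

Lemma evalp_vpoly c x : evalp (vpoly c) x = (c *m monom_vec d x) ord0 ord0.
Proof.
rewrite mxE evalp_sum; apply: eq_bigr => k _.
by rewrite /evalp mevalZ mevalX mxE.
Qed.

Lemma mcoeff_vpoly c k :
  mcoeff (tnth (in_tuple (monoms n d)) k) (vpoly c) = c ord0 k.
Proof.
rewrite raddf_sum (bigD1 k) //= mcoeffZ mcoeffX eqxx mulr1.
rewrite big1 ?addr0 // => l lk; rewrite mcoeffZ mcoeffX.
rewrite (inj_eq (tuple_uniqP (in_tuple (monoms n d)) monoms_uniq)).
by rewrite (negbTE lk) mulr0.
Qed.

Lemma vpoly_onto p : (msize p <= d.+1)%N -> exists c, p = vpoly c.
Proof.
move=> pd; exists (\row_k mcoeff (tnth (in_tuple (monoms n d)) k) p).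
apply/mpolyP => b; have [|] := boolP (b \in monoms n d).
  by case/(tnthP (in_tuple (monoms n d))) => k ->; rewrite mcoeff_vpoly mxE.
move=> bd; rewrite memN_msupp_eq0; last first.
  by rewrite msize_mdeg_ge // (leq_trans pd) // leqNgt -mem_monoms.
rewrite raddf_sum /= big1 // => k _; rewrite mcoeffZ mcoeffX.
case: eqP => [E|]; last by rewrite mulr0.
by move: bd; rewrite -E mem_tnth.
Qed.

Hypothesis mu_int : poly_integrable mu.

Lemma pint_vpolyM c w : pint mu (vpoly c * vpoly w) = (c *m M *m w^T) ord0 ord0.
Proof.
rewrite mxE /vpoly mulr_suml pint_sum //.
under eq_bigr do rewrite mulr_sumr pint_sum //.
rewrite exchange_big /=.
apply: eq_bigr => l _; rewrite !mxE big_distrl /=; apply: eq_bigr => k _.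
rewrite -scalerAl -scalerAr !pintZ // -mpolyXD pintX // !mxE.
by rewrite mulrA mulrAC.
Qed.

Hypothesis mu_pos : forall p, pint mu (p * p) = 0 -> p = 0.

(** A row [c] in the kernel yields a polynomial whose square has integral 0; by definiteness it is
    zero, and its coefficients are the entries of [c]. *)
Lemma moment_matrix_unit : M \in unitmx.
Proof.
rewrite -row_free_unit -kermx_eq0; apply/eqP/row_matrixP => i.
rewrite row0; set c := row i _.
have cM : c *m M = 0 by rewrite -row_mul mulmx_ker row0.
have : vpoly c = 0 by apply: mu_pos; rewrite pint_vpolyM cM mul0mx mxE.
by move=> v0; apply/rowP => k; rewrite -mcoeff_vpoly v0 mcoeff0 mxE.
Qed.

Lemma moment_matrix_sym : M^T = M.
Proof. by apply/matrixP => k l; rewrite !mxE addmC. Qed.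

(** The polynomial [vpoly w] is the reproducing kernel at [x]: its integral against [p] is [p(x)],
    and against itself [christoffel d mu x]. Cauchy-Schwarz concludes. *)
Lemma christoffel_ge p x : (msize p <= d.+1)%N ->
  evalp p x ^+ 2 <= pint mu (p * p) * christoffel d mu x.
Proof.
move=> /vpoly_onto[c ->].
set w := (monom_vec d x)^T *m invmx M.
have Mw : M *m w^T = monom_vec d x.
  rewrite trmx_mul trmx_inv moment_matrix_sym trmxK mulKVmx //.
  exact: moment_matrix_unit.
have := pint_cauchy_schwarz mu_int (vpoly c) (vpoly w).
rewrite !(pint_vpolyM _ w) -!mulmxA Mw -evalp_vpoly.
by rewrite /christoffel -mulmxA.
Qed.

(** Integrating the entries of [v v^T] gives [M], so the mean is the trace of [M^-1 M], the number
    of monomials. *)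
Lemma christoffel_poly : exists2 p : mpoly n R,
  evalp p = christoffel d mu & pint mu p = sz%:R.
Proof.
pose X k := mpolyX R (tnth (in_tuple (monoms n d)) k).
exists (\sum_k \sum_l invmx M k l *: (X k * X l)).
  apply/funext => x; rewrite evalp_sum /christoffel mxE.
  under eq_bigr do rewrite evalp_sum.
  rewrite exchange_big /=; apply: eq_bigr => l _; rewrite !mxE big_distrl /=.
  apply: eq_bigr => k _; rewrite /evalp mevalZ mevalM !mevalX !mxE.
  by rewrite mulrCA mulrA.
rewrite pint_sum // -mxtrace1 -(mulVmx moment_matrix_unit).
apply: eq_bigr => k _; rewrite pint_sum // mxE; apply: eq_bigr => l _.
by rewrite pintZ // -mpolyXD pintX mxE addmC.
Qed.

(** Exponent vectors inject into the [n]-tuples over [0..d] of sum at most [d], which the binomial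
    counts. *)
Lemma size_monoms : (sz <= 'C(d + n, n))%N.
Proof.
rewrite /sz size_sort size_map -cardE addnC -card_partial_ord_partitions.
pose h (b : bmultinom n d.+1) := [tuple (inord (b i) : 'I_d.+1) | i < n].
have bi (b : bmultinom n d.+1) (i : 'I_n) : (b i < d.+1)%N.
  by apply: leq_ltn_trans (bmdeg b); rewrite mdegE (bigD1 i) //= leq_addr.
have h_inj : injective h.
  move=> b c /(congr1 (fun t => tnth t)) bc; apply/val_inj/mnmP => i.
  by move: (congr1 (fun F => val (F i)) bc); rewrite /= !tnth_mktuple !inordK.
rewrite -(card_imset _ h_inj).
apply/subset_leq_card/fintype.subsetP => _ /imsetP[b _ ->].
rewrite inE big_tuple (eq_bigr (fun i => b i)) => [|i _].
  by rewrite -mdegE -ltnS bmdeg.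
by rewrite tnth_mktuple inordK.
Qed.

End christoffel.

(** * Borel measures and their supports *)

Lemma compact_closed_rV (R : realType) n (X : set 'rV[R]_n) :
  compact X -> closed X.
Proof.
apply: compact_closed; exact: pseudoMetricNormedZModType_hausdorff.
Qed.

Section borel_measure.
Context {R : realType} {n : nat} {mu : {measure set (borel R n) -> \bar R}}.

Lemma open_borel (U : set 'rV[R]_n) :
  open U -> measurable (U : set (borel R n)).
Proof. by move=> oU; exact: sub_sigma_algebra. Qed.

Lemma closed_borel (A : set 'rV[R]_n) :
  closed A -> measurable (A : set (borel R n)).
Proof.
move=> cA; rewrite -[A]setCK; apply: measurableC; apply: open_borel.
exact: closed_openC.
Qed.

Lemma continuous_borel (f : 'rV[R]_n -> R) :
  continuous f -> measurable_fun (setT : set (borel R n)) f.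
Proof.
move=> /continuousP cf; apply: (measurability _ (RGenOpens.measurableE R)).
move=> _ [_ [a [b ->] <-]]; rewrite setTI; apply: open_borel.
exact/cf/interval_open.
Qed.

(** Every point off the support has a null open neighbourhood; finitely many of these cover [K]. *)
Lemma mu_compact_disjoint (K : set 'rV[R]_n) : compact K -> closed K ->
  K `&` measure_support mu = set0 -> mu K = 0%E.
Proof.
move=> cK clK KS.
pose null (U : set 'rV[R]_n) := open U /\ mu U = 0%E.
move: cK; rewrite compact_cover => /(_ _ null id).
case => [U [//]|x Kx|F Fnull KF].
  have /existsNP[U /not_implyP[oU /not_implyP[Ux U0]]] :
      ~ measure_support mu x.
    by move=> Sx; have : set0 x by rewrite -KS.
  exists U => //; split => //; apply/eqP; rewrite eq_le measure_ge0 andbT.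
  by rewrite leNgt; apply/negP.
apply/negligibleP; first exact: closed_borel.
apply: (@negligibleS _ (borel R n) _ mu _ _ KF); rewrite /cover bigcup_fset.
rewrite big_seq; elim/big_ind : _ => [|A B|U /Fnull].
- exact: negligible_set0.
- exact: negligibleU.
- by rewrite inE => -[oU U0]; apply/negligibleP => //; exact: open_borel.
Qed.

Lemma le_pint (D : set 'rV[R]_n) p q : poly_integrable mu ->
  measurable (D : set (borel R n)) -> mu (~` D) = 0%E ->
  (forall x, D x -> evalp p x <= evalp q x) -> pint mu p <= pint mu q.
Proof.
move=> mu_int mD D0 pq.
have pintE r : pint mu r = \int[mu]_(x in D) evalp r x.
  congr fine; rewrite (negligible_integral (measurableC mD) _ (mu_int r)) //.
  by rewrite setTD setCK.
rewrite !pintE; apply: le_Rintegral => //.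
  by apply: integrableS (mu_int p).
by apply: integrableS (mu_int q).
Qed.

(** If [p(y) <> 0] at an interior point [y] of the support, then [|p|] exceeds [|p(y)| / 2] on an
    open set around [y], of positive measure, so the integral of [p^2] is positive. Hence [p]
    vanishes on the interior, and is zero. *)
Lemma pint_sqr_eq0 p :
  poly_integrable mu -> interior (measure_support mu) !=set0 ->
  pint mu (p * p) = 0 -> p = 0.
Proof.
move=> mu_int [x0 Sx0] p0.
apply: (evalp_open_eq0 p (interior (measure_support mu)));
  last move=> y /interior_subset Sy.
- by exists x0.
- exact: open_interior.
apply/eqP/negP => /negP py.
pose c := `|evalp p y| / 2.
have c0 : 0 < c by rewrite divr_gt0 ?normr_gt0.
pose U := [set z | c < `|evalp p z|].
have oU : open U.
  apply: (@open_comp _ _ (fun z => `|evalp p z|) [set r | c < r]);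
    last exact: open_gt.
  move=> z _; apply: continuous_comp; first exact: evalp_continuous.
  exact: norm_continuous.
have Uy : U y by rewrite /U /= ltr_pdivrMr // ltr_pMr ?normr_gt0 // ltr1n.
have mU := open_borel _ oU.
have : (\int[mu]_(x in U) (c ^+ 2)%:E <= (pint mu (p * p))%:E)%E.
  have pp_int := mu_int (p * p).
  have pp_ge0 (z : borel R n) : 0 <= evalp (p * p) z.
    by rewrite /evalp mevalM -expr2 sqr_ge0.
  have mpp : measurable_fun (setT : set (borel R n)) (evalp (p * p)).
    apply: continuous_borel; exact: evalp_continuous.
  rewrite /pint /Rintegral fineK; last exact: integrable_fin_num pp_int.
  apply: (@le_trans _ _ (\int[mu]_(x in U) (evalp (p * p) x)%:E)%E).
    apply: ge0_le_integral => //.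
    - by move=> z _; rewrite lee_fin sqr_ge0.
    - by apply/measurable_EFinP; exact: measurable_funTS mpp.
    - move=> z Uz; rewrite lee_fin /evalp mevalM -expr2.
      rewrite -[leRHS]real_normK ?num_real //.
      by rewrite lerXn2r ?nnegrE ?(ltW c0) // ltW.
  apply: ge0_subset_integral => //.
    exact/measurable_EFinP.
  by move=> z _; rewrite lee_fin.
rewrite p0 integral_cst // leNgt => /negP; apply.
by rewrite mule_gt0 ?lte_fin ?exprn_gt0 // Sy.
Qed.

(** A polynomial is bounded on the compact [X], and the complement of [X] is null. *)
Lemma compact_poly_integrable (X : set 'rV[R]_n) : (mu setT < +oo)%E ->
  compact X -> mu (~` X) = 0%E -> poly_integrable mu.
Proof.
move=> muoo cX X0 p.
have mX : measurable (X : set (borel R n)).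
  by apply: closed_borel; apply: compact_closed_rV.
have mp : measurable_fun (setT : set (borel R n)) (evalp p).
  apply: continuous_borel; exact: evalp_continuous.
have /integrableP[_ pX] : mu.-integrable X (EFin \o evalp p).
  apply: measurable_bounded_integrable => //.
  - apply: (@le_lt_trans _ _ (mu setT)) => //.
    by apply: le_measure; rewrite ?inE.
  - exact: measurable_funTS.
  - have /compact_bounded : compact (evalp p @` X).
      apply: continuous_compact => //; apply: continuous_subspaceT.
      exact: evalp_continuous.
    move=> [M [Mr MX]]; exists M; split => // r Mr' x Xx /=.
    by apply: MX => //; exists x.
apply/integrableP; split; first exact/measurable_EFinP.
rewrite (ge0_negligible_integral (measurableC mX)) ?setTD ?setCK //.
by apply: measurableT_comp => //; exact/measurable_EFinP.
Qed.

End borel_measure.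

Lemma pintC {R : realType} {n} (mu : probability (borel R n) R) (c : R) :
  pint mu (mpolyC n c) = c.
Proof.
rewrite /pint; under eq_Rintegral do rewrite /evalp mevalC.
by rewrite Rintegral_cst // [X in fine X](probability_setT mu) mulr1.
Qed.

(** * Needle polynomials *)

(** [msize] is the degree plus one, except that it is 0 at the zero polynomial; hence the successors
    and the two separate cases. *)
Lemma msizeM_leS {R : realType} {n} (p q : mpoly n R) a b :
  (msize p <= a.+1)%N -> (msize q <= b.+1)%N -> (msize (p * q) <= (a + b).+1)%N.
Proof.
have [->|p0] := eqVneq p 0; first by rewrite mul0r msize0.
have [->|q0] := eqVneq q 0; first by rewrite mulr0 msize0.
move=> pa qb; rewrite msizeM //.
by case: (_ + _)%N (leq_add pa qb) => //= k; rewrite addSn addnS ltnS.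
Qed.

Definition sqdist_poly {R : realType} {n} (x : 'rV[R]_n) : mpoly n R :=
  \sum_(i < n) (mpolyX R (mnm1 i) - mpolyC n (x ord0 i)) ^+ 2.

Lemma eucl_dist_sqr {R : realType} {n} (x y : 'rV[R]_n) :
  eucl_dist x y ^+ 2 = evalp (sqdist_poly x) y.
Proof.
rewrite sqr_sqrtr ?sumr_ge0 // => [|i _]; last exact: sqr_ge0.
rewrite evalp_sum; apply: eq_bigr => i _.
by rewrite /evalp rmorphXn rmorphB /= mevalXU mevalC !mxE -sqrrN opprB.
Qed.

Lemma eucl_dist_ge0 {R : realType} {n} (x y : 'rV[R]_n) : 0 <= eucl_dist x y.
Proof. exact: sqrtr_ge0. Qed.

Lemma msize_sqdist_poly {R : realType} {n} (x : 'rV[R]_n) :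
  (msize (sqdist_poly x) <= 3)%N.
Proof.
apply: leq_trans (msize_sum _ _ _) _; apply/bigmax_leqP => i _.
have Xi : (msize (mpolyX R (mnm1 i) - mpolyC n (x ord0 i)) <= 2)%N.
  apply: leq_trans (msizeD_le _ _) _; rewrite msizeN msizeX mdeg1 geq_max leqnn.
  by rewrite msizeC; case: eqP.
by rewrite expr2; exact: (msizeM_leS _ _ 1 1 Xi Xi).
Qed.

Definition needle {R : realType} {n} (x : 'rV[R]_n) (M : R) k : mpoly n R :=
  (mpolyC n 1 - M^-1 *: sqdist_poly x) ^+ k.

Lemma msize_needle {R : realType} {n} (x : 'rV[R]_n) M k :
  (msize (needle x M k) <= k.*2.+1)%N.
Proof.
elim: k => [|k IHk]; first by rewrite /needle expr0 msize1.
rewrite /needle exprSr doubleS -addn2; apply: msizeM_leS => //.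
apply: leq_trans (msizeD_le _ _) _; rewrite msizeN geq_max msize1 /=.
exact: leq_trans (msizeZ_le _ _) (msize_sqdist_poly x).
Qed.

Lemma evalp_needle {R : realType} {n} (x : 'rV[R]_n) M k y :
  evalp (needle x M k) y = (1 - eucl_dist x y ^+ 2 / M) ^+ k.
Proof.
rewrite eucl_dist_sqr /evalp rmorphXn rmorphB /= mevalC mevalZ.
by rewrite [M^-1 * _]mulrC.
Qed.

(** Coordinatewise, [(x - y)^2 <= 2 x^2 + 2 y^2] because [(x + y)^2 >= 0]. *)
Lemma eucl_dist_sqr_le {R : realType} {n} (B : R) (x y : 'rV[R]_n) :
  \sum_(i < n) x ord0 i ^+ 2 <= B -> \sum_(i < n) y ord0 i ^+ 2 <= B ->
  eucl_dist x y ^+ 2 <= 4 * B.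
Proof.
move=> xB yB; rewrite sqr_sqrtr ?sumr_ge0 // => [|i _]; last exact: sqr_ge0.
have : \sum_(i < n) (x - y) ord0 i ^+ 2 <=
    \sum_(i < n) (2 * x ord0 i ^+ 2 + 2 * y ord0 i ^+ 2).
  apply: ler_sum => i _; rewrite !mxE.
  by have := sqr_ge0 (x ord0 i + y ord0 i); nra.
by rewrite big_split /= -!mulr_sumr; lra.
Qed.

(** * Bounds on the Christoffel polynomial *)

Section christoffel_bounds.
Context {R : realType} {n : nat} {mu : probability (borel R n) R}.
Variables (X : set 'rV[R]_n) (B : R).
Hypotheses (X_compact : compact X) (muX : supported_on mu X).
Hypothesis X_bounded : forall x, X x -> \sum_(i < n) x ord0 i ^+ 2 <= B.
Local Notation S := (measure_support mu).
Hypothesis S_interior : interior S !=set0.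

Lemma support_sub : S `<=` X.
Proof.
move=> y Sy; apply: contrapT => nXy.
have /closed_openC oX := compact_closed_rV _ _ _ X_compact.
have : (0 < mu (~` X))%E by apply: Sy => //.
by rewrite muX ltxx.
Qed.

Lemma supported_integrable : poly_integrable mu.
Proof.
apply: (compact_poly_integrable X) => //.
by rewrite [X in (X < _)%E](probability_setT mu) ltry.
Qed.

Lemma supported_definite p : pint mu (p * p) = 0 -> p = 0.
Proof. exact: pint_sqr_eq0 supported_integrable S_interior. Qed.

(** Extremality applied to the constant polynomial 1, whose square has integral 1. *)
Lemma christoffel_ge1 d x : 1 <= christoffel d mu x.
Proof.
have := @christoffel_ge _ _ d mu supported_integrable supported_definite 1 x.
rewrite msize1 => /(_ isT); rewrite /evalp mulr1 meval1 expr1n.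
by rewrite (pintC mu 1) mul1r.
Qed.

Lemma borel_X : measurable (X : set (borel R n)).
Proof. by apply: closed_borel; exact: compact_closed_rV. Qed.

(** Otherwise the Christoffel polynomial exceeds [c] on all of [X], so its mean is at least [c], yet
    that mean is at most the binomial. *)
Lemma christoffel_sublevel d c : 'C(d + n, n)%:R < c ->
  exists2 x, X x & christoffel d mu x <= c.
Proof.
move=> dc; apply: contrapT => noX.
have [p pE pI] :=
  christoffel_poly (d := d) supported_integrable supported_definite.
have : c <= pint mu p.
  rewrite -(pintC mu c).
  apply: (le_pint X _ _ supported_integrable borel_X muX) => x Xx.
  rewrite pE /evalp mevalC leNgt; apply/negP => /ltW pc; apply: noX.
  by exists x.
rewrite pI leNgt (le_lt_trans _ dc) // ler_nat; exact: size_monoms.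
Qed.

(** The denominator exceeds both [4 * B], a bound on the squared diameter of [X], and [eps ^+ 2], so
    the powers compared have nonnegative bases. The exponent is that of the squared needle, with [d]
    rounded down to an even number. *)
Lemma christoffel_away d (eps : R) x : 0 < eps -> X x ->
  (forall y, S y -> eps < eucl_dist x y) ->
  1 <= (1 - eps ^+ 2 / (4 * B + eps ^+ 2 + 1)) ^+ (2 * d./2)
    * christoffel d mu x.
Proof.
move=> e0 Xx Sx; set M := 4 * B + _ + 1; set s := 1 - _.
have B0 : 0 <= B.
  apply: le_trans (X_bounded _ Xx); apply: sumr_ge0 => i _; exact: sqr_ge0.
have M0 : 0 < M by rewrite /M; have := sqr_ge0 eps; lra.
pose A := [set y | evalp (sqdist_poly x) y <= eps ^+ 2].
have clA : closed A.
  apply: (@closed_comp _ _ (evalp (sqdist_poly x)) [set r | r <= eps ^+ 2]).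
    by move=> z _; exact: evalp_continuous.
  exact: closed_le.
have clX := compact_closed_rV _ _ _ X_compact.
have clXA : closed (X `&` A) by exact: closedI.
have XA0 : mu (X `&` A) = 0%E.
  apply: mu_compact_disjoint => //; first exact: compact_closedI.
  apply/seteqP; split => [y [[_ Ay] Sy]|//]; move: (Sx y Sy).
  rewrite -ltr_sqr ?nnegrE ?(ltW e0) ?eucl_dist_ge0 //.
  by rewrite eucl_dist_sqr ltNge Ay.
have mXA := closed_borel _ clXA.
pose D := X `\` A.
have mD : measurable (D : set (borel R n)).
  by apply: measurableD; [exact: borel_X|exact: closed_borel].
have D0 : mu (~` D) = 0%E.
  have -> : ~` D = ~` X `|` (X `&` A).
    rewrite /D setDE setCI setCK; apply/seteqP; split => y /=.
      by case: (pselect (X y)) => Xy [|]; [left|right|left|left].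
    by move=> [|[]]; [left|right].
  by apply: null_set_setU => //; exact: measurableC borel_X.
set q := needle x M d./2.
have qd : (msize q <= d.+1)%N.
  apply: leq_trans (msize_needle _ _ _) _.
  by rewrite ltnS -{2}(odd_double_half d) leq_addl.
have := christoffel_ge supported_integrable supported_definite q x qd.
have -> : evalp q x = 1.
  rewrite evalp_needle eucl_dist_sqr evalp_sum.
  rewrite big1 ?mul0r ?subr0 ?expr1n // => i _.
  by rewrite /evalp rmorphXn rmorphB /= mevalXU mevalC subrr expr0n.
rewrite expr1n => /le_trans; apply.
apply: ler_wpM2r; first by apply: le_trans (christoffel_ge1 d x).
rewrite -(pintC mu (s ^+ _)).
apply: (le_pint D _ _ supported_integrable mD D0) => y [Xy /negP].
rewrite -ltNge -eucl_dist_sqr => ey.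
rewrite /evalp mevalC mevalM -/(evalp q y) evalp_needle -expr2 -exprM mulnC.
have xyB := eucl_dist_sqr_le _ _ _ (X_bounded _ Xx) (X_bounded _ Xy).
have xyM : eucl_dist x y ^+ 2 / M <= 1.
  by rewrite ler_pdivrMr // mul1r /M; have := sqr_ge0 eps; lra.
apply: lerXn2r; rewrite ?nnegrE ?subr_ge0 //.
  rewrite ler_pdivrMr // mul1r /M; lra.
by rewrite lerB // ler_pM2r ?invr_gt0 // ltW.
Qed.

End christoffel_bounds.

(** * Estimates on the degree condition *)

(** Induction on [(n+1) C(d+n+1, n+1) = (d+n+1) C(d+n, n)], with [d+n+1 <= (n+1)(d+1)]. *)
Lemma bin_le_expn d n : ('C(d + n, n) <= d.+1 ^ n)%N.
Proof.
elim: n => [|n IHn]; first by rewrite bin0.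
rewrite -(leq_pmul2l (ltn0Sn n)) -mul_bin_diag addnS /= expnS mulnA.
by apply: leq_mul => //; rewrite mulSn mulnS; lia.
Qed.

(** The factors [2^3] and [exp(n^2/d)] are at least 1, and [2^(-u) >= exp(-u)] for [u >= 0] since
    [ln 2 <= 1]; here [u = delta d / (delta + diam S)] is at most [tau d]. *)
Lemma degree_lhs_ge {R : realType} {n} (S : set 'rV[R]_n) (delta tau : R) d :
  (0 < n)%N -> 0 < delta -> 0 < eucl_diam S -> delta <= tau * eucl_diam S ->
  expR (- tau) ^+ d * d%:R ^+ n * (expR 1 / n%:R) ^+ n <= degree_lhs S delta d.
Proof.
move=> n0 delta0 D0 deltaD; rewrite /degree_lhs.
set D := eucl_diam S in D0 deltaD *.
have nR0 : 0 < n%:R :> R by rewrite ltr0n.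
have e0 : 0 <= (expR 1 / n%:R) ^+ n :> R.
  by rewrite exprn_ge0 // divr_ge0 ?expR_ge0 ?ler0n.
rewrite -[leLHS]mulr1; apply: ler_pM => //; last 2 first.
- apply: ler_wpM2r => //; apply: ler_wpM2r; first exact: exprn_ge0.
  rewrite /powR pnatr_eq0 /= -expRM_natl ler_expR.
  have ln2 : 0 <= ln (2 : R) <= 1.
    rewrite ln_ge0 ?ler1n //=; apply: le_trans (@le_ln1Dx R 1 _) => //; lra.
  case/andP: ln2 => ln20 ln21.
  have : delta * d%:R / (delta + D) * ln 2 <= d%:R * tau.
    have -> : d%:R * tau = (d%:R * tau) * 1 by rewrite mulr1.
    apply: ler_pM => //.
      by rewrite divr_ge0 ?mulr_ge0 ?ler0n ?addr_ge0 // ltW.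
    rewrite ler_pdivrMr ?addr_gt0 // mulrC -mulrA ler_wpM2l ?ler0n //.
    have tau0 : 0 <= tau.
      by rewrite -(pmulr_lge0 _ D0); apply: le_trans deltaD; exact: ltW.
    by rewrite mulrDr; have := mulr_ge0 tau0 (ltW delta0); lra.
  lra.
- by apply: le_trans (expR_ge1Dx _); rewrite lerDl divr_ge0 // exprn_ge0.
Qed.

(** The last fraction is at most 1, factor by factor. The sign of [c] is read off from that of
    [alpha_of], which avoids evaluating [vol] and [Gamma_fun]. *)
Lemma alpha_of_bound {R : realType} {n} (S : set 'rV[R]_n) (delta : R) d :
  (0 < d)%N ->
  let c := sphere_surface R n / fine (vol S) in
  0 < alpha_of S delta d -> 0 < delta ->
  0 < c /\ alpha_of S delta d <= delta ^+ n * c.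
Proof.
move=> d0 c; rewrite /alpha_of -(mulrA _ (sphere_surface R n)) -/c -mulrA.
set t := _ / _; move=> a0 delta0.
have den0 : 0 < ((d + n + 1) * (d + n + 2) * (2 * d + n + 6))%:R :> R.
  by rewrite ltr0n !muln_gt0 !addn1 !addn2 !addnS.
have t0 : 0 < t by rewrite divr_gt0 // ltr0n !muln_gt0 !addn1 !addnS.
have t1 : t <= 1.
  rewrite ler_pdivrMr // mul1r ler_nat.
  by apply: leq_mul; [apply: leq_mul|]; lia.
have c0 : 0 < delta ^+ n * c by rewrite -(pmulr_lgt0 _ t0).
split; first by move: c0; rewrite pmulr_rgt0 // exprn_gt0.
by rewrite -[leRHS]mulr1 ler_wpM2l // ltW.
Qed.

(** An interior point can be moved along the first axis within [S]; boundedness of [S] makes [sup] a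
    genuine upper bound of the distances. *)
Lemma eucl_diam_gt0 {R : realType} {n} (S : set 'rV[R]_n) (B : R) :
  (0 < n)%N -> (forall x, S x -> \sum_(i < n) x ord0 i ^+ 2 <= B) ->
  interior S !=set0 -> 0 < eucl_diam S.
Proof.
move=> n0 SB [x Sx].
have /nbhs_ballP[e /= e0 eS] : nbhs x S by exact: Sx.
pose y : 'rV[R]_n := x - (e / 2) *: delta_mx ord0 (Ordinal n0).
have Sy : S y.
  apply: eS; rewrite -ball_normE /= /y opprD opprK addrA subrr add0r.
  rewrite normrZ (gtr0_norm (divr_gt0 e0 _)) //.
  have d1 : `|delta_mx ord0 (Ordinal n0) : 'rV[R]_n| <= 1.
    rewrite [leLHS]/Num.norm /= mx_normrE.
    apply/bigmax_leP; split => // -[i j] _ /=.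
    by rewrite mxE; case: (_ && _); rewrite ?normr1 ?normr0.
  apply: (@le_lt_trans _ _ (e / 2 * 1)).
    by rewrite ler_wpM2l // divr_ge0 // ltW.
  by rewrite mulr1 ltr_pdivrMr // ltr_pMr // ltr1n.
have xy : 0 < eucl_dist x y.
  rewrite sqrtr_gt0 (bigD1 (Ordinal n0)) //= ltr_wpDr //.
    by apply: sumr_ge0 => i _; exact: sqr_ge0.
  rewrite !mxE !eqxx /= mulr1 opprD opprK addrA subrr add0r exprn_gt0 //.
  by rewrite divr_gt0.
apply: (lt_le_trans xy); apply: ub_le_sup; last first.
  exists x; first exact: interior_subset.
  by exists y.
exists (Num.sqrt (4 * B)) => _ [u Su [v Sv <-]].
rewrite -[leLHS]ger0_norm ?eucl_dist_ge0 // -sqrtr_sqr ler_wsqrtr //.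
by apply: eucl_dist_sqr_le; exact: SB.
Qed.

Lemma eucl_dist_to_ge0 {R : realType} {n} (S : set 'rV[R]_n) x :
  S !=set0 -> 0 <= eucl_dist_to x S.
Proof.
move=> [y Sy]; apply: lb_le_inf; first by exists (eucl_dist x y), y.
by move=> _ [z _ <-]; exact: eucl_dist_ge0.
Qed.

Lemma eucl_dist_to_le {R : realType} {n} (S : set 'rV[R]_n) x y :
  S y -> eucl_dist_to x S <= eucl_dist x y.
Proof.
move=> Sy; apply: ge_inf; last by exists y.
by exists 0 => _ [z _ <-]; exact: eucl_dist_ge0.
Qed.

(* Up to constants, [alpha / d^n] is at least [sigma^d] and at most
   [s^d = sigma^(2d)], so [sigma^d], hence [alpha], has a lower bound free
   of [d]. *)
Lemma level_lower_bound {R : realFieldType} (n d : nat)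
    (sigma s kappa p alpha : R) :
  (0 < d)%N -> 0 < sigma -> sigma ^+ 2 = s -> s <= 1 -> 0 < kappa ->
  sigma ^+ d * d%:R ^+ n * kappa <= alpha ->
  p <= 'C(d + n, n)%:R / alpha -> 1 <= s ^+ (2 * d./2) * p ->
  kappa * (kappa * s / 2 ^+ n) <= alpha.
Proof.
move=> d0 sigma0 sigmaE s1 kappa0 lhs_alpha pC ps.
have s0 : 0 < s by rewrite -sigmaE exprn_gt0.
have dR1 : 1 <= d%:R ^+ n :> R by rewrite exprn_ege1 // ler1n.
have dn0 : 0 < d%:R ^+ n :> R by apply: lt_le_trans dR1.
have sd0 : 0 < sigma ^+ d by rewrite exprn_gt0.
have alpha0 : 0 < alpha by apply: lt_le_trans lhs_alpha; rewrite !mulr_gt0.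
have alpha_le : alpha <= s ^+ (2 * d./2) * 'C(d + n, n)%:R.
  rewrite -[leLHS]mul1r -ler_pdivlMr // -mulrA; apply: le_trans ps _.
  by rewrite ler_wpM2l // exprn_ge0 // ltW.
(* Uses [d + 1 <= 2 d], as [d > 0]. *)
have C_le : 'C(d + n, n)%:R <= 2 ^+ n * d%:R ^+ n :> R.
  rewrite -exprMn -natrM -natrX ler_nat; apply: leq_trans (bin_le_expn d n) _.
  by have [->//|n0] := posnP n; rewrite leq_exp2r //; lia.
(* The extra factor [s] absorbs the rounding: [d <= 2 * d./2 + 1]. *)
have s_pow : s ^+ (2 * d./2) * s <= sigma ^+ d * sigma ^+ d.
  rewrite -exprSr -exprD addnn -mul2n exprM sigmaE.
  by apply: ler_wiXn2l; rewrite ?(ltW s0) //; lia.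
have key : kappa * s <= sigma ^+ d * 2 ^+ n.
  rewrite -(ler_pM2l (mulr_gt0 sd0 dn0)) mulrA.
  apply: (@le_trans _ _ (alpha * s)); first by rewrite ler_wpM2r // ltW.
  apply: (@le_trans _ _ (s ^+ (2 * d./2) * 'C(d + n, n)%:R * s)).
    by rewrite ler_wpM2r // ltW.
  rewrite mulrAC.
  apply: (@le_trans _ _ (sigma ^+ d * sigma ^+ d * (2 ^+ n * d%:R ^+ n)));
    last first.
    by rewrite le_eqVlt; apply/orP; left; apply/eqP; ring.
  by apply: ler_pM; rewrite ?mulr_ge0 ?exprn_ge0 // ltW.
(* [key] bounds [sigma ^+ d] below by [kappa * s / 2 ^+ n], and [d ^ n >= 1]. *)
apply: le_trans lhs_alpha; rewrite mulrC ler_pM2r //.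
rewrite ler_pdivrMr ?exprn_gt0 //; apply: le_trans key _.
by rewrite ler_pM2r ?exprn_gt0 // ler_peMr // ltW.
Qed.

(** * Convergence of the sublevel sets to the support *)

Lemma semialg_ball {R : realType} {n m} (g : 'I_m -> mpoly n R) (N : int) x :
  (exists j, g j = ball_constraint R n N) -> semialg g x ->
  \sum_(i < n) x ord0 i ^+ 2 <= N%:~R.
Proof.
move=> [j gj] /(_ j); rewrite gj /evalp rmorphB rmorph_sum /= mevalC subr_ge0.
by under eq_bigr do rewrite rmorphXn /= mevalXU.
Qed.

Theorem theorem4p7 (R : realType) (n m : nat) (n_gt0 : (0 < n)%N)
    (t : time_kind) (f : 'I_n -> mpoly n R) (g : 'I_m -> mpoly n R)
    (N : int) (ball_g : exists j, g j = ball_constraint R n N)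
    (X := semialg g) (X_compact : compact X)
    (mu : probability (borel R n) R)
    (mu_supported : supported_on mu X)
    (mu_invariant : invariant_measure t (polymap f) X mu)
    (mu_unique : forall nu : probability (borel R n) R,
        supported_on nu X -> invariant_measure t (polymap f) X nu ->
        forall A : set (borel R n), measurable A -> nu A = mu A)
    (S := measure_support mu) (S_interior : interior S !=set0)
    (delta alpha : nat -> R) (d : nat -> nat)
    (delta_decreasing : nonincreasing_seq delta)
    (delta_gt0 : forall r, 0 < delta r)
    (delta_cvg0 : delta r @[r --> \oo] --> 0)
    (d_least : forall r, is_least
        (fun k => (0 < k)%N /\
          degree_lhs S (delta r) k <= alpha_of S (delta r) k) (d r))
    (alphaE : forall r, alpha r = alpha_of S (delta r) (d r))
    (Sr := fun r => [set x | X x /\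
        christoffel (d r) mu x <= 'C(d r + n, n)%:R / alpha r]) :
  ereal_sup [set (eucl_dist_to x S)%:E | x in Sr r] @[r --> \oo] --> 0%E.
Proof.
have XB x : X x -> \sum_(i < n) x ord0 i ^+ 2 <= N%:~R by exact: semialg_ball.
have SX : S `<=` X by apply: support_sub.
have S0 : S !=set0 by case: S_interior => x /interior_subset Sx; exists x.
have B0 : 0 <= N%:~R :> R.
  case: S0 => x /SX/XB; apply: le_trans; apply: sumr_ge0 => i _; exact: sqr_ge0.
have D0 : 0 < eucl_diam S.
  by apply: (eucl_diam_gt0 S N%:~R) => // x /SX; exact: XB.
have d_gt0 r : (0 < d r)%N by case: (d_least r) => -[].
have lhs_alpha r : degree_lhs S (delta r) (d r) <= alpha r.
  by rewrite alphaE; case: (d_least r) => -[].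
set kappa := (expR 1 / n%:R) ^+ n : R.
have kappa0 : 0 < kappa by rewrite exprn_gt0 // divr_gt0 ?expR_gt0 ?ltr0n.
(* Positivity comes from the degree condition, whose left side is positive. *)
have alpha_gt0 r : 0 < alpha r.
  apply: lt_le_trans (lhs_alpha r); rewrite /degree_lhs.
  by rewrite !mulr_gt0 ?powR_gt0 ?expR_gt0 ?exprn_gt0 ?divr_gt0 ?expR_gt0
    ?ltr0n.
have alpha_cvg0 : alpha r @[r --> \oo] --> 0.
  pose c := sphere_surface R n / fine (vol S).
  have bound r : 0 < c /\ alpha r <= delta r ^+ n * c.
    by rewrite alphaE; apply: alpha_of_bound => //; rewrite -alphaE.
  apply: (@squeeze_cvgr _ _ _ _ (cst 0) (fun r => delta r ^+ n * c)).
  - by near=> r; rewrite /= ltW //=; case: (bound r).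
  - exact: cvg_cst.
  - rewrite -[X in _ --> X](mul0r c); apply: cvgMr_tmp.
    rewrite -[X in _ --> X](_ : 0 ^+ n = 0); last by rewrite expr0n gtn_eqF.
    have := @exprn_continuous R n 0.
    exact: (@cvg_comp _ _ _ delta _ _ (nbhs (0 : R))).
(* The lower bound makes the supremum finite, since it excludes [-oo]. *)
have sup_small e : 0 < e -> \forall r \near \oo,
    (0 <= ereal_sup [set (eucl_dist_to x S)%:E | x in Sr r] <= e%:E)%E.
  move=> e0; set s := 1 - e ^+ 2 / (4 * N%:~R + e ^+ 2 + 1).
  have e20 : 0 < e ^+ 2 by rewrite exprn_gt0.
  have s0 : 0 < s by rewrite subr_gt0 ltr_pdivrMr; lra.
  have s1 : s < 1 by rewrite ltrBlDr ltrDl divr_gt0 //; lra.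
  (* Chosen so that [exp(-tau)] is the square root of [s]: the degree condition then loses only half
     of the exponential rate of the needle. *)
  pose tau := - ln s / 2.
  have tau0 : 0 < tau by rewrite divr_gt0 // oppr_gt0 ln_lt0 // s0.
  have tauE : expR (- tau) ^+ 2 = s.
    rewrite -expRM_natl (_ : _ * _ = ln s) ?lnK ?posrE //.
    by rewrite /tau; field.
  have alpha_near c : 0 < c -> \forall r \near \oo, alpha r < c.
    move=> c0; apply: filterS (cvgr0_norm_lt _ alpha_cvg0 _ c0) => r.
    by apply: le_lt_trans; exact: ler_norm.
  have delta_near : \forall r \near \oo, delta r <= tau * eucl_diam S.
    apply: filterS (cvgr0_norm_lt _ delta_cvg0 _ (mulr_gt0 tau0 D0)) => r.
    by move/ltW; apply: le_trans; exact: ler_norm.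
  have c0 : 0 < kappa * (kappa * s / 2 ^+ n).
    have p2 : 0 < 2 ^+ n :> R by exact: exprn_gt0.
    by rewrite mulr_gt0 // divr_gt0 // mulr_gt0.
  near=> r.
  have alpha_r : alpha r < kappa * (kappa * s / 2 ^+ n).
    by near: r; exact: alpha_near.
  (* This puts the threshold strictly above the binomial, so that [Sr r] is nonempty. *)
  have alpha_r1 : alpha r < 1 by near: r; exact: alpha_near.
  have delta_r : delta r <= tau * eucl_diam S by near: r.
  apply/andP; split.
    have [|x Xx px] := christoffel_sublevel X X_compact mu_supported S_interior
      (d r) ('C(d r + n, n)%:R / alpha r).
      by rewrite ltr_pdivlMr // gtr_pMr // ltr0n bin_gt0 leq_addl.
    apply: le_ereal_sup_tmp; exists (eucl_dist_to x S)%:E; first by exists x.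
    by rewrite lee_fin eucl_dist_to_ge0.
  apply: ge_ereal_sup => _ [x [Xx px] <-].
  rewrite lee_fin leNgt; apply/negP => xS.
  move: alpha_r; rewrite ltNge => /negP; apply.
  apply: (level_lower_bound n (d r) (expR (- tau)) s kappa
    _ _ _ _ _ _ _ _ px) => //.
  - exact: expR_gt0.
  - exact: ltW.
  - by apply: le_trans (lhs_alpha r); exact: degree_lhs_ge.
  - apply: (christoffel_away X N%:~R X_compact mu_supported XB S_interior)
      => // y Sy.
    by apply: lt_le_trans xS _; exact: eucl_dist_to_le.
(* Convergence in the extended reals splits into eventual finiteness, obtained from the bound at 1,
   and convergence of the real values. *)
apply/fine_cvgP; split.
  apply: filterS (sup_small 1 ltr01) => r /andP[r0 r1].
  by rewrite ge0_fin_numE // (le_lt_trans r1) // ltry.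
apply/cvgrPdist_le => e e0.
apply: filterS (sup_small e e0) => r /= /andP[r0 re].
have rfin : ereal_sup [set (eucl_dist_to x S)%:E | x in Sr r] \is a fin_num.
  by rewrite ge0_fin_numE // (le_lt_trans re) // ltry.
by rewrite sub0r normrN ger0_norm ?fine_ge0 // -lee_fin fineK.
Unshelve. all: by end_near.
Qed.
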